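(* Let $(X,d_X)$ be a $\mathrm{CAT}(0)$ space. For any $a,b,c,s,t\in[0,1]$ with $a\leq s$, and any points $x_0,x_1,y_0,y_1,z_0,z_1\in X$, the following inequality $(\ast)$ holds: \begin{align*} &sta\big((1-t)(1-a)+(1-s)tb\big)\,d_X(x_0,x_1)^2 + s(1-t)t(1-b)b\,d_X(y_0,y_1)^2 + ab(1-c)c\,d_X(z_0,z_1)^2\\ &\quad\leq (1-s)tab(1-c)\,d_X(x_0,z_0)^2 + stab(1-c)\,d_X(x_1,z_0)^2 + (1-t)ab(1-c)\,d_X(y_1,z_0)^2\\ &\qquad + (1-s)tabc\,d_X(x_0,z_1)^2 + stabc\,d_X(x_1,z_1)^2 + (1-t)abc\,d_X(y_1,z_1)^2\\ &\qquad + s(1-t)t(1-a)(1-b)\,d_X(x_0,y_0)^2 + s(1-t)ta(1-b)\,d_X(x_1,y_0)^2 + (1-t)t(s-a)b\,d_X(x_0,y_1)^2. \end{align*} Moreover, for any $a,b,c,s,t\in(0,1)$ with $a<s$, there exists a $6$-point metric space $(L,d_L)$ that satisfies the following two conditions: (i) every $5$-point subset of $L$ (with the restricted metric) admits a distance-preserving embedding into a $\mathrm{CAT}(0)$ space; (ii) $L$ does not satisfy $(\ast)$ for the parameters $a,b,c,s,t$; more precisely, there exist $x_0,x_1,y_0,y_1,z_0,z_1\in L$ such that $(\ast)$ fails with $d_X$ replaced by $d_L$ and with the given parameters $a,b,c,s,t$.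
   Context: A geodesic in a metric space $X$ is a distance-preserving embedding of an interval of the real line into $X$. A metric space $X$ is geodesic if for any $x,y\in X$ there is a geodesic $\gamma\colon[0,d_X(x,y)]\to X$ with $\gamma(0)=x$ and $\gamma(d_X(x,y))=y$. A complete geodesic metric space $(X,d_X)$ is called a $\mathrm{CAT}(0)$ space if for any $x,y\in X$ and any geodesic $\gamma\colon[0,d_X(x,y)]\to X$ with $\gamma(0)=x$ and $\gamma(d_X(x,y))=y$, the inequality $$d_X(z,\gamma(\tau d_X(x,y)))^2\leq(1-\tau)d_X(z,x)^2+\tau d_X(z,y)^2-(1-\tau)\tau d_X(x,y)^2$$ holds for every $z\in X$ and every $\tau\in[0,1]$. A map between metric spaces is a distance-preserving embedding if it preserves all distances. *)

(* Defs.v *)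
From mathcomp Require Import all_boot all_order all_algebra.
From mathcomp Require Import all_classical all_reals all_analysis.
Set Implicit Arguments.
Unset Strict Implicit.
Unset Printing Implicit Defensive.
Import Order.TTheory GRing.Theory Num.Theory.
Local Open Scope classical_set_scope.
Local Open Scope ring_scope.

(* A map defined on the subset A of X is represented by a total function,
   whose values outside of A are irrelevant. *)
Definition dist_preserving_on (R : realType) (X Y : metricType R)
    (A : set X) (f : X -> Y) : Prop :=
  {in A &, forall u v, mdist (f u) (f v) = mdist u v}.

(* The metric of R^o is the usual distance of the real line. *)
Definition geodesic_from_to (R : realType) (X : metricType R) (x y : X)
    (gamma : R^o -> X) : Prop :=
  [/\ dist_preserving_on (`[0, mdist x y] : set R^o) gamma,
      gamma 0 = x & gamma (mdist x y) = y].

Definition geodesic_space (R : realType) (X : metricType R) : Prop :=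
  forall x y : X, exists gamma : R^o -> X, geodesic_from_to x y gamma.

(* This is the axiom of completeType with the convergence to some point made
   explicit: completeType requires a distinguished point, metricType has none. *)
Definition complete_space (T : uniformType) : Prop :=
  forall F : set_system T, ProperFilter F -> cauchy F -> exists l : T, F --> l.

Definition CAT0 (R : realType) (X : metricType R) : Prop :=
  [/\ complete_space X,
      geodesic_space X
    & forall (x y : X) (gamma : R^o -> X), geodesic_from_to x y gamma ->
      forall (z : X) (tau : R), 0 <= tau <= 1 ->
        mdist z (gamma (tau * mdist x y)) ^+ 2 <=
          (1 - tau) * mdist z x ^+ 2 + tau * mdist z y ^+ 2
          - (1 - tau) * tau * mdist x y ^+ 2].

Definition six_point_ineq (R : realType) (X : metricType R) (a b c s t : R)
    (x0 x1 y0 y1 z0 z1 : X) : Prop :=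
  s * t * a * ((1 - t) * (1 - a) + (1 - s) * t * b) * mdist x0 x1 ^+ 2
  + s * (1 - t) * t * (1 - b) * b * mdist y0 y1 ^+ 2
  + a * b * (1 - c) * c * mdist z0 z1 ^+ 2
  <=
  (1 - s) * t * a * b * (1 - c) * mdist x0 z0 ^+ 2
  + s * t * a * b * (1 - c) * mdist x1 z0 ^+ 2
  + (1 - t) * a * b * (1 - c) * mdist y1 z0 ^+ 2
  + (1 - s) * t * a * b * c * mdist x0 z1 ^+ 2
  + s * t * a * b * c * mdist x1 z1 ^+ 2
  + (1 - t) * a * b * c * mdist y1 z1 ^+ 2
  + s * (1 - t) * t * (1 - a) * (1 - b) * mdist x0 y0 ^+ 2
  + s * (1 - t) * t * a * (1 - b) * mdist x1 y0 ^+ 2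
  + (1 - t) * t * (s - a) * b * mdist x0 y1 ^+ 2.

(* Main.v *)
Require Import Defs.
From HB Require Import structures.
From mathcomp Require Import all_boot all_order all_algebra.
From mathcomp Require Import all_classical all_reals all_analysis.
From mathcomp Require Import ring lra.
Set Implicit Arguments.
Unset Strict Implicit.
Unset Printing Implicit Defensive.
Import Order.TTheory GRing.Theory Num.Theory.
Import numFieldNormedType.Exports.
Local Open Scope classical_set_scope.
Local Open Scope card_scope.
Local Open Scope ring_scope.

(* With p = (1 - s) x0 + s x1 and q = (1 - t) y1 + t p, pick w on [x0, p] (in
   the ratio a / s, which requires a <= s), r on [z0, z1] and u on [y0, y1].
   The inequality is a nonnegative combination of CAT(0) inequalities for these
   points with d(q, r)^2 >= 0 and d(w, u)^2 >= 0.

   For the sharpness, start with six points of R^3 for which equality holds and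
   increase only d(z0, z1)^2, by a small k > 0.  Omitting z0 or z1 leaves a
   Euclidean configuration.  If any other point is omitted, the remaining five
   points have a one-dimensional space of affine dependencies, and three
   coefficients of such a dependency have the same sign.  This makes every small
   perturbation of the distances realizable in the product of a Euclidean space
   and a star, where the three points lie on different legs. *)

(** * The six-point inequality in CAT(0) spaces *)

(** The distance to [x] is recorded because the segment from [x] to the chosen point is itself
    divided later. *)
Lemma CAT0_point (R : realType) (X : metricType R) (x y : X) (tau : R) :
  CAT0 X -> 0 <= tau <= 1 ->
  exists2 m : X, mdist x m = tau * mdist x y &
    forall z, mdist z m ^+ 2 <= (1 - tau) * mdist z x ^+ 2
      + tau * mdist z y ^+ 2 - (1 - tau) * tau * mdist x y ^+ 2.
Proof.
move=> [_ geoX cnX] tau01; have [gamma Hgamma] := geoX x y.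
exists (gamma (tau * mdist x y)); last by move=> z; exact: cnX.
have [iso g0 _] := Hgamma; have d0 := mdist_ge0 x y.
have /andP[tau0 tau1] := tau01.
have td0 : 0 <= tau * mdist x y by exact: mulr_ge0.
rewrite -{1}g0 iso; first by rewrite /mdist/= subr0 ger0_norm.
- by rewrite inE/= in_itv/= lexx.
- by rewrite inE/= in_itv/= td0 ler_piMl.
Qed.

Lemma CAT0_six_point (R : realType) (X : metricType R) (a b c s t : R)
    (x0 x1 y0 y1 z0 z1 : X) : CAT0 X ->
  0 <= a <= 1 -> 0 <= b <= 1 -> 0 <= c <= 1 -> 0 <= s <= 1 -> 0 <= t <= 1 ->
  a <= s -> six_point_ineq a b c s t x0 x1 y0 y1 z0 z1.
Proof.
move=> X0 a01 b01 c01 s01 t01 les; rewrite /six_point_ineq.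
have /andP[a0 a1] := a01; have /andP[b0 b1] := b01.
have /andP[c0 c1] := c01; have /andP[s0 s1] := s01; have /andP[t0 t1] := t01.
(* For [s = 0] the hypothesis [a <= s] gives [a = 0] and every coefficient vanishes; otherwise the
   ratio [a / s] makes sense. *)
have [s_eq0|sN0] := eqVneq s 0.
  have a_eq0 : a = 0 by apply/le_anti; rewrite a0 -s_eq0 les.
  by rewrite s_eq0 a_eq0 !(mul0r, mulr0, addr0, subr0).
have s_gt0 : 0 < s by rewrite lt_neqAle eq_sym sN0.
pose k := a / s; have ak : a = k * s by rewrite /k divfK.
have k0 : 0 <= k by rewrite divr_ge0.
have k1 : k <= 1 by rewrite ler_pdivrMr// mul1r.
have k01 : 0 <= k <= 1 by rewrite k0.
clearbody k.
have [p dp Hp] := CAT0_point x0 x1 X0 s01.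
have [q _ Hq] := CAT0_point y1 p X0 t01.
have [r _ Hr] := CAT0_point z0 z1 X0 c01.
have [w _ Hw] := CAT0_point x0 p X0 k01.
have [u _ Hu] := CAT0_point y0 y1 X0 b01.
have /(le_trans (sqr_ge0 _)) Hqr := Hr q.
have /(le_trans (sqr_ge0 _)) Hwu := Hu w.
have {Hq} [Hq0 Hq1] := (Hq z0, Hq z1).
have {Hw} [Hw0 Hw1] := (Hw y0, Hw y1).
have {Hp} [[Hp0 Hp1] Hpy] := ((Hp z0, Hp z1), Hp y0).
rewrite dp exprMn in Hw0 Hw1.
rewrite -(metric_sym z0 q) -(metric_sym z1 q) in Hqr.
rewrite -(metric_sym y0 w) -(metric_sym y1 w) in Hwu.
rewrite !(metric_sym x0 z0, metric_sym x1 z0, metric_sym y1 z0,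
  metric_sym x0 z1, metric_sym x1 z1, metric_sym y1 z1,
  metric_sym x0 y0, metric_sym x1 y0, metric_sym x0 y1).
rewrite ak.
have [b'0 c'0 t'0] : [/\ 0 <= 1 - b, 0 <= 1 - c & 0 <= 1 - t]
  by split; rewrite subr_ge0.
have tt0 : 0 <= t * (1 - t) by exact: mulr_ge0.
have kb0 : 0 <= k * s * b := mulr_ge0 (mulr_ge0 k0 s0) b0.
move: (mdist x0 x1 ^+ 2) (mdist y0 y1 ^+ 2) (mdist z0 z1 ^+ 2)
  (mdist z0 q ^+ 2) (mdist z1 q ^+ 2) (mdist y1 p ^+ 2) (mdist z0 p ^+ 2)
  (mdist z1 p ^+ 2) (mdist y0 w ^+ 2) (mdist y1 w ^+ 2) (mdist y0 p ^+ 2)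
  Hqr Hwu Hq0 Hq1 Hw0 Hw1 Hp0 Hp1 Hpy.
move=> X2 Y2 Z2 z0q z1q y1p z0p z1p y0w y1w y0p.
move=> Hqr Hwu Hq0 Hq1 Hw0 Hw1 Hp0 Hp1 Hpy.
(* The chain through [q], [r] gets the weight [k * s * b], which is [a * b], and the chain through
   [w], [u] the weight [s * (t * (1 - t))]. With these weights d(y1, p)^2 cancels between [Hq0],
   [Hq1] and [Hw1]; the other auxiliary distances cancel within their chain. *)
have {}Hqr := ler_wpM2l kb0 Hqr.
have {}Hq0 := ler_wpM2l (mulr_ge0 kb0 c'0) Hq0.
have {}Hq1 := ler_wpM2l (mulr_ge0 kb0 c0) Hq1.
have {}Hp0 := ler_wpM2l (mulr_ge0 (mulr_ge0 kb0 c'0) t0) Hp0.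
have {}Hp1 := ler_wpM2l (mulr_ge0 (mulr_ge0 kb0 c0) t0) Hp1.
have st0 := mulr_ge0 s0 tt0.
have {}Hwu := ler_wpM2l st0 Hwu.
have {}Hw0 := ler_wpM2l (mulr_ge0 st0 b'0) Hw0.
have {}Hw1 := ler_wpM2l (mulr_ge0 st0 b0) Hw1.
have {}Hpy := ler_wpM2l (mulr_ge0 (mulr_ge0 st0 b'0) k0) Hpy.
lra.
Qed.

(** * Metrics given by squared distances, and a criterion for CAT(0) *)

(** Squared distances are the primitive data because the CAT(0) inequality and the perturbations
    below are linear in them. *)
Record sqdist (R : realType) (T : Type) := Sqdist {
  sqd :> T -> T -> R;
  sqd_ge0 : forall x y, 0 <= sqd x y;
  sqdxx : forall x, sqd x x = 0;
  sqd_eq0 : forall x y, sqd x y = 0 -> x = y;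
  sqd_sym : forall x y, sqd x y = sqd y x;
  sqd_triangle : forall y x z,
    Num.sqrt (sqd x z) <= Num.sqrt (sqd x y) + Num.sqrt (sqd y z) }.

(* The metric of this alias is the square root of d. *)
Definition metric_of (R : realType) (T : Type) (d : sqdist R T) : Type := T.

HB.instance Definition _ (R : realType) (T : Type) (d : sqdist R T) :=
  gen_eqMixin (metric_of d).
HB.instance Definition _ (R : realType) (T : Type) (d : sqdist R T) :=
  gen_choiceMixin (metric_of d).

Lemma sqrt_sqd_eq0 (R : realType) (T : Type) (d : sqdist R T) (x y : T) :
  Num.sqrt (d x y) = 0 -> x = y.
Proof.
move/eqP; rewrite sqrtr_eq0 => dle0; apply: (@sqd_eq0 _ _ d).
by apply/le_anti; rewrite dle0 sqd_ge0.
Qed.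

Lemma sqrt_sqdxx (R : realType) (T : Type) (d : sqdist R T) (x : T) :
  Num.sqrt (d x x) = 0.
Proof. by rewrite sqdxx sqrtr0. Qed.

Lemma sqrt_sqd_sym (R : realType) (T : Type) (d : sqdist R T) (x y : T) :
  Num.sqrt (d x y) = Num.sqrt (d y x).
Proof. by rewrite sqd_sym. Qed.

HB.instance Definition _ (R : realType) (T : Type) (d : sqdist R T) :=
  @isMetric.Build R (metric_of d) (fun x y => Num.sqrt (d x y))
    (@sqrt_sqdxx R T d) (@sqrt_sqd_eq0 R T d) (@sqrt_sqd_sym R T d)
    (@sqd_triangle R T d).

Lemma mdist_metric_of (R : realType) (T : Type) (d : sqdist R T)
  (x y : metric_of d) : mdist x y = Num.sqrt (d x y).
Proof. by []. Qed.

Lemma mdist_sqr (R : realType) (T : Type) (d : sqdist R T)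
  (x y : metric_of d) : mdist x y ^+ 2 = d x y.
Proof. by rewrite mdist_metric_of sqr_sqrtr// sqd_ge0. Qed.

(** The inequality of Bruhat and Tits, for every ratio and with a chosen dividing point. *)
Definition CN (R : realType) (T : Type) (D : T -> T -> R)
    (m : T -> T -> R -> T) :=
  forall x y tau, 0 <= tau <= 1 -> forall z,
    D z (m x y tau) <= (1 - tau) * D z x + tau * D z y
                       - (1 - tau) * tau * D x y.

(* Evaluating the inequality at y, with m dividing [x, z] in the ratio
   A : B of the distances A = d(x, y) and B = d(y, z), gives
   0 <= A B - A B d(x, z)^2 / (A + B)^2. *)
Lemma CN_triangle (R : realType) (T : Type) (D : T -> T -> R)
    (m : T -> T -> R -> T) :
  (forall x y, 0 <= D x y) -> (forall x y, D x y = 0 -> x = y) ->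
  (forall x y, D x y = D y x) -> CN D m ->
  forall y x z, Num.sqrt (D x z) <= Num.sqrt (D x y) + Num.sqrt (D y z).
Proof.
move=> D0 Deq0 Dsym cn y x z.
have [xy0|xyN0] := eqVneq (D x y) 0.
  by rewrite xy0 sqrtr0 add0r (Deq0 _ _ xy0).
have [yz0|yzN0] := eqVneq (D y z) 0.
  by rewrite yz0 sqrtr0 addr0 (Deq0 _ _ yz0).
set A := Num.sqrt (D x y); set B := Num.sqrt (D y z).
have A0 : 0 < A by rewrite sqrtr_gt0 lt_neqAle eq_sym xyN0 D0.
have B0 : 0 < B by rewrite sqrtr_gt0 lt_neqAle eq_sym yzN0 D0.
have AB0 : 0 < A + B by rewrite addr_gt0.
have tau01 : 0 <= A / (A + B) <= 1.
  by rewrite (divr_ge0 (ltW A0) (ltW AB0))/= ler_pdivrMr// mul1r lerDl ltW.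
have /(le_trans (D0 _ _)) := cn x z _ tau01 y.
rewrite (Dsym y x) -(@sqr_sqrtr _ (D x y))// -(@sqr_sqrtr _ (D y z))//.
rewrite -/A -/B => cny.
rewrite -(ger0_norm (ltW AB0)) -sqrtr_sqr.
apply: ler_wsqrtr.
have AB_gt0 : 0 < A * B by exact: mulr_gt0.
suff : A * B * D x z <= A * B * (A + B) ^+ 2 by rewrite ler_pM2l.
have := ler_wpM2l (sqr_ge0 (A + B)) cny.
have -> : (A + B) ^+ 2 * ((1 - A / (A + B)) * A ^+ 2 + A / (A + B) * B ^+ 2
    - (1 - A / (A + B)) * (A / (A + B)) * D x z) =
    A * B * (A + B) ^+ 2 - A * B * D x z by field; rewrite gt_eqF.
lra.
Qed.

(** Taking [z] equal to [x] or [y] bounds the distances from [m x y tau] to the endpoints, and the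
    triangle inequality turns the bound at [x] into an equality. So [m] traces a geodesic, and every
    geodesic with the same endpoints coincides with it. *)
Lemma CN_CAT0 (R : realType) (T : Type) (d : sqdist R T)
    (m : T -> T -> R -> T) :
  complete_space (metric_of d) -> CN d m -> CAT0 (metric_of d).
Proof.
move=> cX cn; pose X : metricType R := metric_of d.
have cnX (x y z : X) (tau : R) : 0 <= tau <= 1 ->
    mdist z (m x y tau : X) ^+ 2 <= (1 - tau) * mdist z x ^+ 2
    + tau * mdist z y ^+ 2 - (1 - tau) * tau * mdist x y ^+ 2.
  by move=> tau01; rewrite !mdist_sqr; exact: cn.
have dx (x y : X) (tau : R) : 0 <= tau <= 1 ->
    mdist x (m x y tau : X) <= tau * mdist x y.
  move=> /[dup] tau01 /andP[tau0 _]; have := cnX x y x _ tau01; rewrite mdistxx.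
  have -> : (1 - tau) * 0 ^+ 2 + tau * mdist x y ^+ 2
     - (1 - tau) * tau * mdist x y ^+ 2 = (tau * mdist x y) ^+ 2 by ring.
  by rewrite ler_sqr// nnegrE ?mdist_ge0// mulr_ge0// mdist_ge0.
have dy (x y : X) (tau : R) : 0 <= tau <= 1 ->
    mdist y (m x y tau : X) <= (1 - tau) * mdist x y.
  move=> /[dup] tau01 /andP[_ tau1]; have := cnX x y y _ tau01.
  rewrite mdistxx (metric_sym y x).
  have -> : (1 - tau) * mdist x y ^+ 2 + tau * 0 ^+ 2
     - (1 - tau) * tau * mdist x y ^+ 2 = ((1 - tau) * mdist x y) ^+ 2 by ring.
  by rewrite ler_sqr// nnegrE ?mdist_ge0// mulr_ge0 ?subr_ge0// mdist_ge0.
have dx_eq (x y : X) (tau : R) : 0 <= tau <= 1 ->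
    mdist x (m x y tau : X) = tau * mdist x y.
  move=> tau01; apply/le_anti; rewrite dx//=.
  have := metric_triangle x (m x y tau : X) y.
  rewrite (metric_sym (m x y tau : X) y); have := dy x y _ tau01; lra.
split => //.
- move=> x y; have [xy0|xyN0] := eqVneq (mdist x y) 0.
    (* The parameter [u / mdist x y] is meaningless here, hence the constant path. *)
    exists (fun=> x); split=> //; last exact: mdist_positivity.
    move=> u v; rewrite !inE/= !in_itv/= xy0 => u0 v0.
    have -> : u = 0 by apply/le_anti; rewrite andbC.
    have -> : v = 0 by apply/le_anti; rewrite andbC.
    by rewrite !mdistxx.
  have xy_gt0 : 0 < mdist x y by rewrite lt_neqAle eq_sym xyN0 mdist_ge0.
  exists (fun u => m x y (u / mdist x y) : X); split.
  + suff sub (u v : R^o) : u \in (`[0, mdist x y]%classic : set R^o) ->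
        v \in (`[0, mdist x y]%classic : set R^o) -> u <= v ->
        mdist (m x y (u / mdist x y) : X) (m x y (v / mdist x y) : X) = v - u.
      move=> u v u0 v0; have [uv|/ltW vu] := lerP u v.
        by rewrite sub// /mdist/= ger0_norm// subr_ge0.
      by rewrite metric_sym sub// /mdist/= distrC ger0_norm// subr_ge0.
    rewrite !inE/= !in_itv/= => /andP[u0 u1] /andP[v0 v1] uv.
    set tu := u / mdist x y; set tv := v / mdist x y.
    have tu01 : 0 <= tu <= 1.
      by rewrite divr_ge0 ?mdist_ge0//= ler_pdivrMr// mul1r.
    have tv01 : 0 <= tv <= 1.
      by rewrite divr_ge0 ?mdist_ge0//= ler_pdivrMr// mul1r.
    have uE : u = tu * mdist x y by rewrite divfK.
    have vE : v = tv * mdist x y by rewrite divfK.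
    have tuv : tu <= tv by rewrite ler_pM2r// invr_gt0.
    (* The lower bound is the triangle inequality from [x]. The upper bound is the inequality for
       [tv] at [z = m x y tu], whose right side is at most [(v - u) ^+ 2]. *)
    apply/le_anti/andP; split; last first.
      have := metric_triangle x (m x y tu : X) (m x y tv : X).
      rewrite !dx_eq// -uE -vE; lra.
    have vu0 : 0 <= v - u by rewrite subr_ge0.
    rewrite -ler_sqr ?nnegrE ?mdist_ge0//.
    apply: (le_trans (cnX x y (m x y tu : X) _ tv01)).
    rewrite (metric_sym (m x y tu : X) x) dx_eq// (metric_sym (m x y tu : X) y).
    have dyu := dy x y _ tu01; have dyu0 := mdist_ge0 y (m x y tu : X).
    have {}dyu : mdist y (m x y tu : X) ^+ 2 <= ((1 - tu) * mdist x y) ^+ 2.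
      by rewrite ler_sqr ?nnegrE// (le_trans dyu0 dyu).
    have /andP[tv0 tv1] := tv01; have := ler_wpM2l tv0 dyu.
    rewrite uE vE; lra.
  + rewrite mul0r; apply/mdist_positivity.
    by rewrite metric_sym dx_eq ?mul0r// lexx ler01.
  + rewrite divff//; apply/mdist_positivity/le_anti.
    rewrite mdist_ge0 andbT metric_sym (le_trans (dy _ _ _ _))// ?lexx ?ler01//.
    by rewrite subrr mul0r.
- move=> x y gamma [iso g0 g1] z tau tau01; have /andP[tau0 tau1] := tau01.
  have d0 := mdist_ge0 x y.
  have mem0 : (0 : R^o) \in (`[0, mdist x y]%classic : set R^o).
    by rewrite inE/= in_itv/= lexx.
  have mem1 : (mdist x y : R^o) \in (`[0, mdist x y]%classic : set R^o).
    by rewrite inE/= in_itv/= lexx andbT.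
  have memt : (tau * mdist x y : R^o) \in (`[0, mdist x y]%classic : set R^o).
    by rewrite inE/= in_itv/= mulr_ge0//= ler_piMl.
  have gx : mdist (gamma (tau * mdist x y)) x = tau * mdist x y.
    rewrite -{2}g0 iso// /mdist/= sub0r normrN ger0_norm//; exact: mulr_ge0.
  have gy : mdist (gamma (tau * mdist x y)) y = (1 - tau) * mdist x y.
    rewrite -{2}g1 iso// [LHS]/mdist/= ger0_norm; first by ring.
    by rewrite subr_ge0 ler_piMl.
  (* At a point with the distances [gx] and [gy] to the endpoints, the right side of the inequality
     vanishes. *)
  suff -> : gamma (tau * mdist x y) = m x y tau by exact: cnX.
  apply: (@mdist_positivity R X); apply/eqP; rewrite -sqrf_eq0.
  apply/eqP/le_anti; rewrite sqr_ge0 andbT.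
  apply: (le_trans (cnX x y _ _ tau01)); rewrite gx gy; lra.
Qed.

(** * The CAT(0) inequality in a star *)

(* A star with four legs of infinite length, realized as the pair of
   coordinate axes of the plane with the l1 distance. *)
Definition cross (R : realType) (p : R * R) := p.1 * p.2 == 0.

Definition l1dist (R : realType) (p q : R * R) : R :=
  `|p.1 - q.1| + `|p.2 - q.2|.

Definition swap (R : realType) (p : R * R) : R * R := (p.2, p.1).

Lemma cross_swap (R : realType) (p : R * R) : cross (swap p) = cross p.
Proof. by rewrite /cross/= mulrC. Qed.

Lemma l1dist_swap (R : realType) (p q : R * R) :
  l1dist (swap p) (swap q) = l1dist p q.
Proof. exact: addrC. Qed.

Lemma l1distC (R : realType) (p q : R * R) : l1dist p q = l1dist q p.
Proof. by rewrite /l1dist distrC [X in _ + X]distrC. Qed.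

(* Folding the star onto a line keeps the distances to m and between the
   endpoints and does not increase the other ones; on the line the
   inequality is an equality. *)
Lemma fold_CN (R : realType) (P Q Z tau zm zp zq pq : R) :
  0 <= tau <= 1 -> zm = `|Z - ((1 - tau) * P + tau * Q)| ->
  `|Z - P| <= zp -> `|Z - Q| <= zq -> pq = `|P - Q| ->
  zm ^+ 2 <= (1 - tau) * zp ^+ 2 + tau * zq ^+ 2 - (1 - tau) * tau * pq ^+ 2.
Proof.
move=> /andP[tau0 tau1] -> hP hQ ->.
have {}hP : (Z - P) ^+ 2 <= zp ^+ 2.
  by rewrite -real_normK ?num_real// ler_sqr// nnegrE// (le_trans _ hP).
have {}hQ : (Z - Q) ^+ 2 <= zq ^+ 2.
  by rewrite -real_normK ?num_real// ler_sqr// nnegrE// (le_trans _ hQ).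
rewrite !real_normK ?num_real//.
have tau'0 : 0 <= 1 - tau by rewrite subr_ge0.
have := lerD (ler_wpM2l tau'0 hP) (ler_wpM2l tau0 hQ); lra.
Qed.

Definition star_between (R : realType) (p q : R * R) (tau : R) :=
  exists2 m, cross m & forall z, cross z ->
    l1dist z m ^+ 2 <= (1 - tau) * l1dist z p ^+ 2 + tau * l1dist z q ^+ 2
      - (1 - tau) * tau * l1dist p q ^+ 2.

Lemma star_between_swap (R : realType) (p q : R * R) (tau : R) :
  star_between (swap p) (swap q) tau -> star_between p q tau.
Proof.
move=> [m crm Hm]; exists (swap m); first by rewrite cross_swap.
move=> z crz; have := Hm (swap z); rewrite cross_swap !l1dist_swap => /(_ crz).
by rewrite -(l1dist_swap (swap z) m).
Qed.

Lemma star_between_sym (R : realType) (p q : R * R) (tau : R) :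
  star_between q p (1 - tau) -> star_between p q tau.
Proof.
move=> [m crm Hm]; exists m => // z /Hm.
by rewrite subKr (l1distC q p) (addrC (tau * _)) (mulrC tau (1 - tau)).
Qed.

Lemma star_between_axis (R : realType) (x y tau : R) :
  0 <= tau <= 1 -> star_between (x, 0) (y, 0) tau.
Proof.
move=> tau01; set m := (1 - tau) * x + tau * y.
exists (m, 0); first by rewrite /cross/= mulr0.
move=> [z1 z2] /=; rewrite /cross/= mulf_eq0 => /orP[]/eqP->.
- rewrite /l1dist/= !(sub0r, subr0, normr0, normrN, addr0).
  (* A point of the other axis is folded to the side of 0 away from [m], so that its path to [m]
     through the center becomes straight. *)
  pose Z := if 0 <= m then - `|z2| else `|z2|.
  have Zle u : `|Z - u| <= `|u| + `|z2|.
    rewrite (le_trans (ler_normB _ _))// addrC lerD2l /Z.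
    by case: ifP; rewrite ?normrN normr_id.
  apply: (@fold_CN _ x y Z _ _ _ _ _ tau01); [|exact: Zle|exact: Zle|by []].
  rewrite -/m /Z.
  case: (lerP 0 m) => m0.
    rewrite -opprD normrN [RHS]ger0_norm; last exact: addr_ge0.
    by rewrite ger0_norm// addrC.
  rewrite [RHS]ger0_norm; first by rewrite ltr0_norm// addrC.
  by rewrite subr_ge0 (le_trans (ltW m0)).
- rewrite /l1dist/= !(sub0r, subr0, normr0, normrN, addr0).
  by apply: (@fold_CN _ x y z1 _ _ _ _ _ tau01).
Qed.

(** The bound on [tau] places the dividing point on the leg of [x]. That leg becomes the positive
    half-line, and the three others are folded onto the negative one. *)
Lemma star_between_corner (R : realType) (x y tau : R) : x != 0 ->
  0 <= tau <= 1 -> tau * (`|x| + `|y|) <= `|x| ->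
  star_between (x, 0) (0, y) tau.
Proof.
move=> xN0 tau01 tx; set d := `|x| + `|y|; set M := `|x| - tau * d.
have x_gt0 : 0 < `|x| by rewrite normr_gt0.
have M0 : 0 <= M by rewrite subr_ge0.
have MlinE : M = (1 - tau) * `|x| + tau * - `|y| by rewrite /M /d; ring.
have [e e1 xE] : exists2 e : R, `|e| = 1 & x = e * `|x|.
  by exists (Num.sg x); [rewrite normr_sg xN0|exact: numEsg].
have e2 : e * e = 1.
  by rewrite -expr2 -real_normK ?num_real// e1 expr1n.
have dE : d = `| `|x| - (- `|y|) | by rewrite opprK ger0_norm// addr_ge0.
exists (e * M, 0); first by rewrite /cross/= mulr0.
have eB u v : `|u - e * v| = `|e * u - v|.
  by rewrite -[RHS]mul1r -{1}e1 -normrM mulrBr mulrA e2 mul1r.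
move=> [z1 z2] /=; rewrite /cross/= mulf_eq0 => /orP[]/eqP->;
  rewrite /l1dist/= !(sub0r, subr0, normrN, normr0, addr0, add0r) -/d.
- apply: (@fold_CN _ `|x| (- `|y|) (- `|z2|) _ _ _ _ _ tau01) => //;
    rewrite -?MlinE.
  + by rewrite normrM e1 mul1r (ger0_norm M0) -opprD normrN
      [RHS]ger0_norm; [rewrite addrC|exact: addr_ge0].
  + by rewrite -opprD normrN ger0_norm; [rewrite addrC|exact: addr_ge0].
  + by rewrite opprK addrC (le_trans (ler_dist_dist _ _))// distrC.
- apply: (@fold_CN _ `|x| (- `|y|) (e * z1) _ _ _ _ _ tau01) => //;
    rewrite -?MlinE.
  + by rewrite eB.
  + by rewrite [in leRHS]xE eB.
  + by rewrite opprK (le_trans (ler_normD _ _))// normrM e1 mul1r normr_id.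
Qed.

Lemma star_CN (R : realType) (p q : R * R) (tau : R) :
  cross p -> cross q -> 0 <= tau <= 1 -> star_between p q tau.
Proof.
have diff (x y : R) t : 0 <= t <= 1 -> star_between (x, 0) (0, y) t.
  move=> t01; have [->|xN0] := eqVneq x 0.
    by apply: star_between_swap; exact: star_between_axis.
  have [->|yN0] := eqVneq y 0; first exact: star_between_axis.
  (* The dividing point lies on the leg of the first endpoint or, after exchanging the endpoints, on
     that of the second. *)
  have [le|lt] := lerP (t * (`|x| + `|y|)) `|x|.
    exact: star_between_corner.
  apply/star_between_sym/star_between_swap; apply: star_between_corner => //.
    by move: t01 => /andP[? ?]; apply/andP; split; lra.
  rewrite addrC; lra.
case: p q => [p1 p2] [q1 q2]; rewrite /cross/= !mulf_eq0.
move=> /orP[]/eqP-> /orP[]/eqP-> tau01.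
- by apply: star_between_swap; exact: star_between_axis.
- by apply: star_between_swap; exact: diff.
- exact: diff.
- exact: star_between_axis.
Qed.

(** * The product of a Euclidean space and the star *)

Definition model (R : realType) (n : nat) :=
  {p : 'rV[R]_n * (R * R) | cross p.2}.

Definition model_sqd (R : realType) (n : nat) (p q : model R n) : R :=
  \sum_k ((val p).1 0 k - (val q).1 0 k) ^+ 2
  + l1dist (val p).2 (val q).2 ^+ 2.

Section ModelSqd.
Context (R : realType) (n : nat).
Implicit Types p q z : model R n.

Lemma model_sqd_ge0 p q : 0 <= model_sqd p q.
Proof. by rewrite addr_ge0 ?sqr_ge0// sumr_ge0// => k _; exact: sqr_ge0. Qed.

Lemma model_sqdxx p : model_sqd p p = 0.
Proof.
rewrite /model_sqd /l1dist !subrr normr0 addr0 expr0n/= addr0 big1// => k _.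
by rewrite subrr expr0n.
Qed.

Lemma model_sqd_sym p q : model_sqd p q = model_sqd q p.
Proof.
rewrite /model_sqd l1distC; congr (_ + _); apply: eq_bigr => k _.
by rewrite -sqrrN opprB.
Qed.

Lemma coord_le_model_sqd p q k :
  ((val p).1 0 k - (val q).1 0 k) ^+ 2 <= model_sqd p q.
Proof.
rewrite /model_sqd (bigD1 k)//= -addrA lerDl addr_ge0 ?sqr_ge0//.
by rewrite sumr_ge0// => *; exact: sqr_ge0.
Qed.

Lemma l1dist_le_model_sqd p q :
  l1dist (val p).2 (val q).2 ^+ 2 <= model_sqd p q.
Proof.
by rewrite /model_sqd lerDr sumr_ge0// => k _; exact: sqr_ge0.
Qed.

Lemma model_sqd_eq0 p q : model_sqd p q = 0 -> p = q.
Proof.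
move=> pq0; apply/val_inj.
rewrite [LHS]surjective_pairing [RHS]surjective_pairing.
have l1 : l1dist (val p).2 (val q).2 = 0.
  by apply/eqP; rewrite -sqrf_eq0 eq_le sqr_ge0 andbT -pq0 l1dist_le_model_sqd.
move/eqP: l1; rewrite paddr_eq0// !normr_eq0 !subr_eq0.
move=> /andP[/eqP e1 /eqP e2].
congr (_, _); last by rewrite [LHS]surjective_pairing e1 e2 -surjective_pairing.
apply/rowP => k; apply/eqP; rewrite -subr_eq0 -sqrf_eq0 eq_le sqr_ge0 andbT.
by rewrite -pq0 coord_le_model_sqd.
Qed.

(** The inequality adds up over the factors: it is an equality in the Euclidean one and [star_CN] in
    the other. *)
Lemma model_CN : {m : model R n -> model R n -> R -> model R n |
  CN (@model_sqd R n) m}.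
Proof.
suff H (u : model R n * model R n * R) : exists m : model R n, 0 <= u.2 <= 1 ->
    forall z, model_sqd z m <= (1 - u.2) * model_sqd z u.1.1
      + u.2 * model_sqd z u.1.2 - (1 - u.2) * u.2 * model_sqd u.1.1 u.1.2.
  have [f fP] := choice H; exists (fun p q tau => f (p, q, tau)).
  by move=> p q tau tau01 z; exact: (fP (p, q, tau)).
move: u => [[p q] tau] /=.
(* Outside the unit interval nothing is claimed, and [p] is a default value. *)
have [tau01|tau01] := boolP (0 <= tau <= 1); last by exists p.
have [m crm Hm] := star_CN (valP p) (valP q) tau01.
exists (exist (fun p : 'rV[R]_n * (R * R) => cross p.2)
  ((1 - tau) *: (val p).1 + tau *: (val q).1, m) crm).
move=> _ z; rewrite /model_sqd/=.
set Sm := \sum_k _; set Sp := \sum_k _; set Sq := \sum_k _; set Spq := \sum_k _.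
have -> : Sm = (1 - tau) * Sp + tau * Sq - (1 - tau) * tau * Spq.
  rewrite /Sm /Sp /Sq /Spq !mulr_sumr -sumrN -!big_split/=.
  by apply: eq_bigr => k _; rewrite !mxE; ring.
by have := Hm _ (valP z); lra.
Qed.

Lemma model_sqd_triangle q p z :
  Num.sqrt (model_sqd p z)
    <= Num.sqrt (model_sqd p q) + Num.sqrt (model_sqd q z).
Proof.
have [m cn] := model_CN.
exact: (CN_triangle model_sqd_ge0 model_sqd_eq0 model_sqd_sym cn).
Qed.

Definition model_sqdist : sqdist R (model R n) :=
  Sqdist model_sqd_ge0 model_sqdxx model_sqd_eq0 model_sqd_sym
    model_sqd_triangle.

Definition model_space : metricType R := metric_of model_sqdist.

Lemma lipschitz_cauchy_cvg (X : metricType R) (F : set_system X)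
    (phi : X -> R) : ProperFilter F -> cauchy F ->
  (forall x y, `|phi x - phi y| <= mdist x y) -> exists l : R, phi @ F --> l.
Proof.
move=> FF Fc lip; suff : cvg (phi @ F) by move=> cphi; exists (lim (phi @ F)).
apply: cauchy_cvg; apply: cauchy_exP => e e0.
have [x Fx] : exists x, F (ball x e) by exact: (cauchyP F).1.
rewrite ballEmdist in Fx; exists (phi x).
change (F [set y | ball (phi x) e (phi y)]).
apply: (filterS _ Fx) => y /= xy; rewrite -ball_normE/=.
exact: le_lt_trans (lip x y) xy.
Qed.

(** The coordinates are 1-Lipschitz, so they converge along a Cauchy filter, and the squared
    distance to the limit is continuous in them. *)
Lemma model_complete : complete_space model_space.
Proof.
move=> F FF Fc.
have nle (u d : R) : u ^+ 2 <= d -> `|u| <= Num.sqrt d.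
  by move=> ud; rewrite -sqrtr_sqr ler_wsqrtr.
have l1le (u : R) (p q : model_space) :
    `|u| <= l1dist (val p).2 (val q).2 -> `|u| <= mdist p q.
  move=> ul; apply: nle; apply: le_trans (l1dist_le_model_sqd _ _).
  by rewrite -real_normK ?num_real// ler_sqr// nnegrE// (le_trans _ ul).
have lcvg k : exists l : R, (fun p : model_space => (val p).1 0 k) @ F --> l.
  apply: lipschitz_cauchy_cvg => // p q.
  exact/nle/coord_le_model_sqd.
have [l lP] := choice lcvg.
have [x xP] : exists x : R, (fun p : model_space => (val p).2.1) @ F --> x.
  apply: lipschitz_cauchy_cvg => // p q.
  by apply: l1le => //; rewrite /l1dist lerDl.
have [y yP] : exists y : R, (fun p : model_space => (val p).2.2) @ F --> y.
  apply: lipschitz_cauchy_cvg => // p q.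
  by apply: l1le => //; rewrite /l1dist lerDr.
(* The star is closed: the product of its two coordinates is 0 along [F], hence in the limit. *)
have crxy : cross (x, y).
  have := cvgM xP yP.
  have -> : (fun p : model_space => (val p).2.1) \*
            (fun p : model_space => (val p).2.2) = fun=> 0.
    by apply/funext => p /=; apply/eqP; exact: (valP p).
  move=> h; apply/eqP/esym.
  have h0 : (fun=> 0 : R) @ F --> (0 : R) by exact: cvg_cst.
  exact: (@norm_cvg_unique R R^o _ _ _ _ h0 (h _)).
pose L : model_space :=
  exist (fun p : 'rV[R]_n * (R * R) => cross p.2) (\row_k l k, (x, y)) crxy.
exists L; apply/metricType_numDomainType.fcvgrPdist_lt => e e0.
have sq (f : model_space -> R) (a : R) :
    f @ F --> a -> (fun p => f p ^+ 2) @ F --> a ^+ 2.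
  by move=> fa; exact: (cvg_comp _ _ fa (@exprn_continuous R 2 a)).
have cL : model_sqd L p @[p --> F] --> (0 : R).
  have -> : (0 : R) =
      \sum_(k < n) (l k - l k) ^+ 2 + (`|x - x| + `|y - y|) ^+ 2.
    rewrite !subrr normr0 addr0 expr0n/= addr0 big1// => k _.
    by rewrite subrr expr0n.
  have -> : (fun p : model_space => model_sqd L p) = (fun p : model_space =>
      \sum_k (l k - (val p).1 0 k) ^+ 2
      + (`|x - (val p).2.1| + `|y - (val p).2.2|) ^+ 2).
    apply/funext => p; rewrite /model_sqd/=; congr (_ + _).
    by apply: eq_bigr => k _; rewrite mxE.
  apply: cvgD; last first.
    apply: sq; apply: cvgD; apply: cvg_norm.
    - by apply: cvgB xP; exact: cvg_cst.
    - by apply: cvgB yP; exact: cvg_cst.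
  apply: (@cvg_big R _ +%R 0 xpredT (@add_continuous R) _ F _
    (fun k (p : model_space) => (l k - (val p).1 0 k) ^+ 2)
    (fun k => (l k - l k) ^+ 2)).
  by move=> k _; apply: sq; apply: cvgB; [exact: cvg_cst|exact: lP].
have e2 : 0 < e ^+ 2 by rewrite exprn_gt0.
have lt : F [set p | model_sqd L p < e ^+ 2] by exact: (cvgr_lt _ cL).
apply: (filterS _ lt) => p /= ltp.
by rewrite /mdist/= -(ger0_norm (ltW e0)) -sqrtr_sqr ltr_sqrt.
Qed.

Lemma model_CAT0 : CAT0 model_space.
Proof. have [m cn] := model_CN; exact: CN_CAT0 model_complete cn. Qed.

End ModelSqd.

(** * Positive semidefinite quadratic forms *)

Definition qform (R : realType) (n : nat) (M : 'M[R]_n) (u : 'rV[R]_n) : R :=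
  (u *m M *m u^T) 0 0.

Lemma qformE (R : realType) (n : nat) (M : 'M[R]_n) (u : 'rV[R]_n) :
  qform M u = \sum_i \sum_j u 0 i * u 0 j * M i j.
Proof.
rewrite /qform mxE exchange_big; apply: eq_bigr => j _ /=.
rewrite !mxE mulr_suml; apply: eq_bigr => i _; ring.
Qed.

Lemma qformD (R : realType) (n : nat) (M N : 'M[R]_n) (u : 'rV[R]_n) :
  qform (M + N) u = qform M u + qform N u.
Proof. by rewrite /qform mulmxDr mulmxDl mxE. Qed.

Lemma qformZ (R : realType) (n : nat) (c : R) (M : 'M[R]_n) (u : 'rV[R]_n) :
  qform (c *: M) u = c * qform M u.
Proof. by rewrite /qform -scalemxAr -scalemxAl mxE. Qed.

Lemma qformZr (R : realType) (n : nat) (c : R) (M : 'M[R]_n) (u : 'rV[R]_n) :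
  qform M (c *: u) = c ^+ 2 * qform M u.
Proof.
by rewrite /qform linearZ/= -!scalemxAl -scalemxAr !mxE mulrA expr2.
Qed.

Lemma qform_gram (R : realType) (n m : nat) (A : 'M[R]_(n, m)) (u : 'rV[R]_n) :
  qform (A *m A^T) u = \sum_k ((u *m A) 0 k) ^+ 2.
Proof.
rewrite /qform mulmxA -(mulmxA _ A^T) -trmx_mul mxE.
by apply: eq_bigr => k _; rewrite [X in _ * X]mxE expr2.
Qed.

Lemma qform_gram_ge0 (R : realType) (n m : nat) (A : 'M[R]_(n, m))
  (u : 'rV[R]_n) : 0 <= qform (A *m A^T) u.
Proof. by rewrite qform_gram sumr_ge0// => k _; exact: sqr_ge0. Qed.

Lemma qform_gram_eq0 (R : realType) (n m : nat) (A : 'M[R]_(n, m))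
  (u : 'rV[R]_n) : qform (A *m A^T) u = 0 -> u *m A = 0.
Proof.
rewrite qform_gram => /eqP; rewrite psumr_eq0; last first.
  by move=> k _; exact: sqr_ge0.
move=> /allP uA0; apply/rowP => k; rewrite [RHS]mxE; apply/eqP.
by have := uA0 k (mem_index_enum k); rewrite sqrf_eq0.
Qed.

Lemma qform_continuous (R : realType) (n : nat) (M : 'M[R]_n) :
  continuous (qform M).
Proof.
move=> u; rewrite (_ : qform M =
  fun u : 'rV_n => \sum_i \sum_j u 0 i * u 0 j * M i j).
  have addc := @add_continuous R.
  apply: (@cvg_big R _ +%R 0 xpredT addc _ (nbhs u) _
    (fun i v => \sum_j v 0 i * v 0 j * M i j) _ (nbhs_filter u)) => i _.
  apply: (@cvg_big R _ +%R 0 xpredT addc _ (nbhs u) _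
    (fun j v => v 0 i * v 0 j * M i j) _ (nbhs_filter u)) => j _.
  by apply: cvgM; [apply: cvgM; exact: coord_continuous|exact: cvg_cst].
by apply/funext => v; exact: qformE.
Qed.

(** By homogeneity only unit vectors with [qform S u <= 0] matter. They form a compact set on which
    [Q] is positive, hence bounded away from 0, while [S] is bounded below. *)
Lemma psd_perturbation (R : realType) (n : nat) (Q S : 'M[R]_n) :
  (forall u, 0 <= qform Q u) ->
  (forall u, u != 0 -> qform Q u = 0 -> 0 < qform S u) ->
  exists2 e : R, 0 < e &
    forall k, 0 < k <= e -> forall u, 0 <= qform (Q + k *: S) u.
Proof.
move=> Q0 QS.
suff [e e0 eP] : exists2 e : R, 0 < e & forall u, `|u| = 1 ->
    qform S u <= 0 -> e * - qform S u <= qform Q u.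
  exists e => // k /andP[k0 ke] u; rewrite qformD qformZ.
  have [->|uN0] := eqVneq u 0.
    by rewrite [X in k * X]/qform !mul0mx mxE mulr0 addr0.
  have u_gt0 : 0 < `|u| by rewrite normr_gt0.
  pose v := `|u|^-1 *: u; have uE : u = `|u| *: v.
    by rewrite scalerA divff ?scale1r// gt_eqF.
  have v1 : `|v| = 1 by rewrite normrZ normfV normr_id mulVf// gt_eqF.
  clearbody v; rewrite uE !qformZr mulrCA -mulrDr mulr_ge0 ?sqr_ge0//.
  have [Sv|/ltW Sv] := lerP (qform S v) 0; last first.
    by rewrite addr_ge0// mulr_ge0// ltW.
  have Sv' : 0 <= - qform S v by rewrite oppr_ge0.
  have := eP v v1 Sv; have := ler_wpM2r Sv' ke; lra.
pose A := [set u : 'rV[R]_n | `|u| = 1 /\ qform S u <= 0].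
have cA : compact A.
  apply: bounded_closed_compact.
    by exists 1; split=> // M M1 u [u1 _]; rewrite /= u1; exact: ltW.
  have -> : A = (fun u => `|u|) @^-1` [set x : R | x = 1]
      `&` qform S @^-1` [set x | x <= 0].
    by [].
  apply: closedI; apply: closed_comp => //.
  - by move=> u _; exact: norm_continuous.
  - by move=> u _; exact: qform_continuous.
have [[u0 Au0]|A0] := pselect (A !=set0); last first.
  by exists 1 => // u u1 Su; exfalso; apply: A0; exists u.
have AN0 : A !=set0 by exists u0.
have cont (M : 'M[R]_n) : {within A, continuous (qform M)}.
  by apply: continuous_subspaceT => u; exact: qform_continuous.
have [c cA' cmin] := EVT_min_rV AN0 cA (cont Q).
have [d dA' dmin] := EVT_min_rV AN0 cA (cont S).
rewrite inE in cA'; have [c1 Sc] := cA'.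
have Qc : 0 < qform Q c.
  rewrite lt_neqAle Q0 andbT eq_sym; apply: contra_leN Sc => /eqP Qc0.
  apply: QS => //; rewrite -normr_gt0 c1; exact: ltr01.
rewrite inE in dA'; have [d1 Sd] := dA'.
have Sd1 : 0 < 1 - qform S d by lra.
(* The minimum of [Q] divided by a bound of [- qform S u]; the added 1 keeps the denominator
   positive. *)
exists (qform Q c / (1 - qform S d)); first exact: divr_gt0.
move=> u u1 Su; have uA : u \in A by rewrite inE.
apply: le_trans (cmin _ uA); rewrite -mulrA ler_piMr ?(ltW Qc)//.
rewrite mulrC ler_pdivrMr// mul1r; have := dmin _ uA; lra.
Qed.

(** Cholesky factorization: the first coordinate is split off, and the induction applies to the
    Schur complement of the pivot [b]. *)
Lemma psd_gram (R : realType) (n : nat) (B : 'M[R]_n) :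
  B^T = B -> (forall u, 0 <= qform B u) -> exists P : 'M[R]_n, B = P *m P^T.
Proof.
elim: n B => [|n IH] B symB psdB; first by exists 0; apply/matrixP => - [].
pose b := B 0 0; pose B1 : 'M[R]_(1 + n) := B; pose r := ursubmx B1.
pose D := drsubmx B1.
have BE : B1 = block_mx b%:M r r^T D.
  rewrite -[LHS]submxK; congr block_mx; last first.
    by rewrite /r trmx_ursub /B1 symB.
  apply/matrixP => i j; rewrite !ord1 !mxE/= /b.
  by congr (B _ _); apply/val_inj.
have symD : D^T = D by rewrite /D trmx_drsub /B1 symB.
clearbody b r D.
have qB (x : R) (v : 'rV_n) :
    0 <= x ^+ 2 * b + 2 * x * (r *m v^T) 0 0 + qform D v.
  have : 0 <= qform B1 (row_mx x%:M v) := psdB _.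
  rewrite /qform BE tr_row_mx mul_row_block mul_row_col !mulmxDl.
  rewrite !tr_scalar_mx !mul_scalar_mx !mul_mx_scalar.
  rewrite -[v *m r^T]trmxK trmx_mul trmxK.
  rewrite -!scalemxAl !mxE/= mulr1n => /le_trans; apply; lra.
have b0 : 0 <= b.
  by have := qB 1 0; rewrite trmx0 mulmx0 /qform mul0mx mul0mx !mxE; lra.
have [b_eq0|bN0] := eqVneq b 0.
  (* For a zero pivot and [v = r] the form is affine in [x]; if [r] were nonzero, a suitable [x]
     would give the value -1. *)
  have r0 : r = 0.
    apply/eqP; rewrite -[_ == _]negbK; apply/negP => rN0.
    have rr : 0 < (r *m r^T) 0 0.
      rewrite lt_neqAle; apply/andP; split; last first.
        by rewrite mxE sumr_ge0// => k _; rewrite mxE -expr2 sqr_ge0.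
      apply: contra rN0; rewrite eq_sym mxE psumr_eq0; last first.
        by move=> k _; rewrite mxE -expr2 sqr_ge0.
      move=> /allP h; apply/eqP/rowP => k; apply/eqP.
      have := h k (mem_index_enum k); rewrite !mxE -expr2 sqrf_eq0//.
    have := qB (- (qform D r + 1) / (2 * (r *m r^T) 0 0)) r.
    rewrite b_eq0 mulr0 add0r.
    have -> : 2 * (- (qform D r + 1) / (2 * (r *m r^T) 0 0)) * (r *m r^T) 0 0
      = - (qform D r + 1) by field; rewrite gt_eqF.
    lra.
  have [v|P DP] := IH D symD.
    by have := qB 0 v; rewrite expr0n/= mul0r mulr0 mul0r !add0r.
  pose M : 'M[R]_(1 + n) := block_mx 0 0 0 P.
  exists M; suff : B1 = M *m M^T by [].
  rewrite /M BE r0 b_eq0 DP tr_block_mx mulmx_block !trmx0 !mul0mx !mulmx0.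
  by rewrite !addr0 add0r raddf0.
have b_gt0 : 0 < b by rewrite lt_neqAle eq_sym bN0.
have [||P DP] := IH (D - b^-1 *: (r^T *m r)).
- by rewrite linearB/= linearZ/= trmx_mul trmxK symD.
(* This [x] minimizes the form for fixed [v], and the minimum is the value of the Schur
   complement. *)
- move=> v; have := qB (- (r *m v^T) 0 0 / b) v.
  rewrite -scaleNr qformD qformZ.
  have -> : r^T *m r = r^T *m (r^T)^T by rewrite trmxK.
  rewrite qform_gram.
  have -> : \sum_k (v *m r^T) 0 k ^+ 2 = (r *m v^T) 0 0 ^+ 2.
    by rewrite big_ord1 -[v *m r^T]trmxK trmx_mul trmxK mxE.
  move=> /le_trans; apply.
  have -> : (- (r *m v^T) 0 0 / b) ^+ 2 * b
      + 2 * (- (r *m v^T) 0 0 / b) * (r *m v^T) 0 0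
     = - b^-1 * (r *m v^T) 0 0 ^+ 2 by field.
  by rewrite addrC.
pose M : 'M[R]_(1 + n) :=
  block_mx (Num.sqrt b)%:M 0 ((Num.sqrt b)^-1 *: r^T) P.
exists M; suff : B1 = M *m M^T by [].
have sb : Num.sqrt b * Num.sqrt b = b by rewrite -expr2 sqr_sqrtr.
have sN0 : Num.sqrt b != 0 by rewrite gt_eqF// sqrtr_gt0.
rewrite /M BE tr_block_mx mulmx_block -DP !trmx0 !mul0mx !mulmx0.
rewrite tr_scalar_mx !mul_scalar_mx !mul_mx_scalar linearZ/= trmxK !addr0.
rewrite scale_scalar_mx sb !scalerA divff// !scale1r.
rewrite -!scalemxAl -!scalemxAr scalerA -invfM sb.
by rewrite addrC subrK.
Qed.

(** * Realization of small perturbations of squared distances *)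

(* If w spans the affine dependencies of the rows of A, then a perturbation S of
   their squared distances is realizable in a Euclidean space to first order as
   soon as \sum_(i, j) w_i w_j S_ij < 0.  The square N of the star distance with
   legs of length 1 / w_i carrying i1, i2, i3 and the other points at the center
   has \sum_(i, j) w_i w_j N_ij = 6, so subtracting a multiple of N from an
   arbitrary S makes it realizable, and the star factor restores N. *)
Section Perturbation.
Context (R : realType) (n m : nat) (A : 'M[R]_(n, m)) (w : 'rV[R]_n).
Context (S : 'M[R]_n) (i1 i2 i3 : 'I_n).
Hypotheses (sumw0 : \sum_i w 0 i = 0).
Hypothesis kerA : forall u : 'rV_n, u *m A = 0 -> exists c, u = c *: w.
Hypotheses (symS : S^T = S) (diagS : forall i, S i i = 0).
Hypotheses (w1 : 0 < w 0 i1) (w2 : 0 < w 0 i2) (w3 : 0 < w 0 i3).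
Hypotheses (i12 : i1 != i2) (i13 : i1 != i3) (i23 : i2 != i3).

Let legs : {set 'I_n} := [set i1; i2; i3].
Let rad i : R := if i \in legs then (w 0 i)^-1 else 0.
Let dir i : R * R :=
  if i == i1 then (1, 0) else if i == i2 then (-1, 0)
  else if i == i3 then (0, 1) else (0, 0).
Let leg i : R * R := (rad i * (dir i).1, rad i * (dir i).2).

Let N : 'M[R]_n := \matrix_(i, j) (if i == j then 0 else (rad i + rad j) ^+ 2).

Let w_legs i : i \in legs -> 0 < w 0 i.
Proof. by rewrite !inE => /orP[/orP[]|] /eqP->. Qed.

Let rad_ge0 i : 0 <= rad i.
Proof. by rewrite /rad; case: ifP => // /w_legs wi; rewrite invr_ge0 ltW. Qed.

Let w_rad i : w 0 i * rad i = (i \in legs)%:R.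
Proof.
rewrite /rad; case: ifP => [/w_legs wi|_]; last by rewrite mulr0.
by rewrite mulfV// gt_eqF.
Qed.

Let sum_legs : \sum_i (i \in legs)%:R = 3 :> R.
Proof.
have -> : \sum_i (i \in legs)%:R = \sum_(i in legs) 1 :> R.
  by rewrite [RHS]big_mkcond/=; apply: eq_bigr => i _; case: ifP.
rewrite sumr_const; congr (_ *+ _).
rewrite /legs -finset.setUA cardsU1 !inE negb_or i12 i13/= cardsU1 inE i23/=.
by rewrite cards1.
Qed.

(** With the diagonal included, the terms in [rad i ^+ 2] vanish as [w] has sum 0, and the mixed
    terms give 2 * 3^2 = 18. The diagonal, which [N] omits, accounts for 4 * 3 = 12. *)
Let qform_N : qform N w = 6.
Proof.
have -> : qform N w = \sum_i \sum_j w 0 i * w 0 j * (rad i + rad j) ^+ 2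
    - 4 * \sum_i (w 0 i * rad i) ^+ 2.
  rewrite qformE mulr_sumr -sumrB; apply: eq_bigr => i _.
  rewrite (bigD1 i)//= [in RHS](bigD1 i)//= mxE eqxx mulr0 add0r.
  rewrite [X in _ = X + _ - _](_ : _ = 4 * (w 0 i * rad i) ^+ 2); last by ring.
  rewrite addrAC subrr add0r; apply: eq_bigr => j ji.
  by rewrite mxE eq_sym (negbTE ji).
have -> : \sum_i \sum_j w 0 i * w 0 j * (rad i + rad j) ^+ 2
   = 2 * (\sum_i w 0 i * rad i) ^+ 2.
  transitivity (\sum_i (w 0 i * rad i ^+ 2 * \sum_j w 0 j
     + 2 * (w 0 i * rad i * \sum_j w 0 j * rad j)
     + w 0 i * \sum_j w 0 j * rad j ^+ 2)).
    apply: eq_bigr => i _; rewrite !mulr_sumr -!big_split/=.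
    by apply: eq_bigr => j _; ring.
  rewrite big_split/= big_split/= sumw0 -!mulr_suml sumw0 mulr0 mul0r.
  by rewrite -mulr_sumr -mulr_suml add0r addr0 expr2.
under eq_bigr do rewrite w_rad.
under [X in _ - 4 * X]eq_bigr do rewrite w_rad -natrX.
have -> : \sum_i ((i \in legs) ^ 2)%:R = \sum_i (i \in legs)%:R :> R.
  by apply: eq_bigr => i _; case: (i \in legs).
by rewrite sum_legs; ring.
Qed.

Let cross_leg c i : cross (c * (leg i).1, c * (leg i).2).
Proof.
rewrite /cross /leg /dir; repeat case: ifP => _ /=;
  by rewrite ?(mulr0, mul0r).
Qed.

Let l1dist_leg c i j : 0 <= c ->
  l1dist (c * (leg i).1, c * (leg i).2) (c * (leg j).1, c * (leg j).2) ^+ 2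
  = c ^+ 2 * N i j.
Proof.
move=> c0; rewrite mxE; case: eqVneq => [->|ij].
  by rewrite /l1dist !subrr normr0 addr0 expr0n mulr0.
rewrite -exprMn /l1dist /= -!mulrBr !normrM (ger0_norm c0) -mulrDr.
congr ((c * _) ^+ 2).
have leg_out k : k \notin legs -> rad k = 0 by rewrite /rad => /negbTE ->.
have norm_dir k : k \in legs -> `|(dir k).1| + `|(dir k).2| = 1.
  rewrite !inE /dir => /orP[/orP[]|] /eqP->; rewrite ?eqxx;
    by repeat case: ifP => _ /=; rewrite ?normrN ?normr0 ?normr1 ?addr0 ?add0r.
have norm_leg k : `|rad k * (dir k).1| + `|rad k * (dir k).2| = rad k.
  have [kl|/leg_out->] := boolP (k \in legs); last first.
    by rewrite !mul0r normr0 addr0.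
  by rewrite !normrM -mulrDr norm_dir// mulr1 ger0_norm.
have [il|/leg_out ri] := boolP (i \in legs); last first.
  by rewrite ri add0r !mul0r !sub0r !normrN norm_leg.
have [jl|/leg_out rj] := boolP (j \in legs); last first.
  by rewrite rj addr0 !mul0r !subr0 norm_leg.
have ri := rad_ge0 i; have rj := rad_ge0 j.
have rij : 0 <= rad i + rad j by exact: addr_ge0.
have i21 := i12; have i31 := i13; have i32 := i23.
rewrite eq_sym in i21; rewrite eq_sym in i31; rewrite eq_sym in i32.
move: il jl; rewrite !inE => /orP[/orP[]|] /eqP iE /orP[/orP[]|] /eqP jE;
  move: ij; rewrite /dir iE jE ?eqxx// => _;
  rewrite ?(negbTE i12, negbTE i13, negbTE i23, negbTE i21, negbTE i31,
    negbTE i32) ?eqxx/=;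
  rewrite -?iE -?jE ?(mulr0, mulr1, mulrN1, opprK, subr0, sub0r, normrN, normr0,
    addr0, add0r) -?opprD ?normrN ?(ger0_norm ri) ?(ger0_norm rj)
    ?(ger0_norm rij)//; exact: addrC.
Qed.

Lemma perturbation_embeds : exists2 e : R, 0 < e &
  forall k, 0 < k <= e -> exists f : 'I_n -> model R n, forall i j,
    model_sqd (f i) (f j) = \sum_l (A i l - A j l) ^+ 2 + k * S i j.
Proof.
(* As [qform N w] is 6, this multiple of [N] makes [qform G w] positive. The factor -1/2 in [G]
   converts squared distances with zero diagonal into Gram entries. *)
pose M := `|qform S w| + 1.
have M0 : 0 <= M by rewrite addr_ge0.
pose G := (- (1 / 2)) *: (S - M *: N).
have Gw : 0 < qform G w.
  rewrite /G qformZ qformD -(scaleNr M N) qformZ qform_N /M.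
  have := ler_norm (qform S w); have := normr_ge0 (qform S w); lra.
have wN0 : forall u : 'rV_n, u != 0 -> qform (A *m A^T) u = 0 -> 0 < qform G u.
  move=> u uN0 /qform_gram_eq0 /kerA[c uE]; rewrite uE qformZr.
  rewrite mulr_gt0// exprn_even_gt0//=; apply: contra uN0 => /eqP c0.
  by rewrite uE c0 scale0r.
have [e e0 psd] := psd_perturbation (@qform_gram_ge0 R n m A) wN0.
exists e => // k /[dup] ke /andP[k0 _].
have symG : G^T = G.
  apply/matrixP => i j; rewrite !mxE eq_sym (addrC (rad j)).
  by rewrite -[in LHS]symS mxE.
have [|P PE] := psd_gram _ (psd k ke).
  by rewrite linearD/= trmx_mul trmxK linearZ/= symG.
(* The scale at which the star contributes [k * M] times [N], the amount removed in [G]. *)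
pose rho := Num.sqrt (k * M).
have rho2 : rho ^+ 2 = k * M by rewrite sqr_sqrtr// mulr_ge0// ltW.
exists (fun i => exist (fun p : 'rV[R]_n * (R * R) => cross p.2)
  (row i P, (rho * (leg i).1, rho * (leg i).2)) (cross_leg rho i)) => i j.
rewrite /model_sqd/= l1dist_leg ?sqrtr_ge0// rho2.
have gramE (p q : nat) (B : 'M[R]_(p, q)) (x y : 'I_p) :
    \sum_l (B x l - B y l) ^+ 2 = (B *m B^T) x x + (B *m B^T) y y
      - 2 * (B *m B^T) x y.
  rewrite !mxE mulr_sumr -sumrN -!big_split/=; apply: eq_bigr => l _.
  by rewrite !mxE; ring.
have -> : \sum_l (row i P 0 l - row j P 0 l) ^+ 2 = \sum_l (P i l - P j l) ^+ 2.
  by apply: eq_bigr => l _; rewrite !mxE.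
rewrite !gramE -PE.
have GE x y : (A *m A^T + k *: G) x y = (A *m A^T) x y
    + k * (- (1 / 2) * (S x y - M * N x y)).
  by rewrite [LHS]mxE; congr (_ + _); rewrite !mxE.
have diagN x : N x x = 0 by rewrite mxE eqxx.
by rewrite !GE !diagS !diagN; field.
Qed.

End Perturbation.

(** * The six-point counterexample *)

Definition q0 : 'I_6 := ord0.
Definition q1 : 'I_6 := lift ord0 ord0.
Definition q2 : 'I_6 := lift ord0 (lift ord0 ord0).
Definition q3 : 'I_6 := lift ord0 (lift ord0 (lift ord0 ord0)).
Definition q4 : 'I_6 := lift ord0 (lift ord0 (lift ord0 (lift ord0 ord0))).
Definition q5 : 'I_6 :=
  lift ord0 (lift ord0 (lift ord0 (lift ord0 (lift ord0 ord0)))).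

Lemma ord6_ind (P : 'I_6 -> Prop) :
  P q0 -> P q1 -> P q2 -> P q3 -> P q4 -> P q5 -> forall i, P i.
Proof.
move=> P0 P1 P2 P3 P4 P5 [[|[|[|[|[|[|//]]]]]] lt6].
- by rewrite (_ : Ordinal _ = q0)//; exact: val_inj.
- by rewrite (_ : Ordinal _ = q1)//; exact: val_inj.
- by rewrite (_ : Ordinal _ = q2)//; exact: val_inj.
- by rewrite (_ : Ordinal _ = q3)//; exact: val_inj.
- by rewrite (_ : Ordinal _ = q4)//; exact: val_inj.
- by rewrite (_ : Ordinal _ = q5)//; exact: val_inj.
Qed.

Lemma big_ord6 (R : realType) (F : 'I_6 -> R) :
  \sum_i F i = F q0 + F q1 + F q2 + F q3 + F q4 + F q5.
Proof. by rewrite !big_ord_recl big_ord0 addr0 !addrA. Qed.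

(** Nonnegativity and the triangle inequality involve at most three points, so they are inherited
    from the embeddings that omit one point. *)
Lemma exists_ord6_avoiding (i j k : 'I_6) :
  exists m, [/\ i != m, j != m & k != m].
Proof.
have [m] : exists m, m \in ~: [set i; j; k]%SET.
  apply/card_gt0P; rewrite cardsCs finset.setCK card_ord subn_gt0.
  have le3 : (#|[set i; j; k]%SET| <= 3)%N.
    by rewrite (leq_trans (leq_card_setU _ _))// cards1 addn1 cards2; case: eqP.
  exact: leq_ltn_trans le3 _.
rewrite !inE !negb_or => /andP[/andP[mi mj] mk]; exists m.
by rewrite ![_ == m]eq_sym.
Qed.

Section SixPoints.
Context (R : realType) (a b c s t : R).
Hypotheses (a01 : 0 < a < 1) (b01 : 0 < b < 1) (c01 : 0 < c < 1).
Hypotheses (s01 : 0 < s < 1) (t01 : 0 < t < 1) (lt_as : a < s).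

(* Rows: x0, x1, y0, y1, z0, z1.  The segments [x0, x1] and [y0, y1] cross at
   the origin; [z0, z1] crosses their plane at
   o = (1 - s) t x0 + s t x1 + (1 - t) y1.  The last coordinate is homogeneous,
   so that the kernel consists of the affine dependencies. *)
Let coords : 'M[R]_(6, 4) := \matrix_(i, l) nth 0 (nth [::]
  [:: [:: - a; 0; 0; 1]; [:: 1 - a; 0; 0; 1];
      [:: 0; - b; 0; 1]; [:: 0; 1 - b; 0; 1];
      [:: t * (s - a); (1 - t) * (1 - b); - c; 1];
      [:: t * (s - a); (1 - t) * (1 - b); 1 - c; 1]] i) l.

(** The coincidence of (1 - a) x0 + a x1 and (1 - b) y0 + b y1, which is the equality case d(w, u) =
    0. *)
Let dep_xy : 'rV[R]_6 :=
  \row_i nth 0 [:: 1 - a; a; - (1 - b); - b; 0; 0] i.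

(** The coincidence of o and (1 - c) z0 + c z1, which is the equality case d(q, r) = 0. *)
Let dep_xyz : 'rV[R]_6 :=
  \row_i nth 0 [:: (1 - s) * t; s * t; 0; 1 - t; - (1 - c); - c] i.

Let dep_xy_coords : dep_xy *m coords = 0.
Proof.
apply/rowP => -[[|[|[|[|//]]]] lt4]; rewrite !mxE big_ord6 !mxE /=; ring.
Qed.

Let dep_xyz_coords : dep_xyz *m coords = 0.
Proof.
apply/rowP => -[[|[|[|[|//]]]] lt4]; rewrite !mxE big_ord6 !mxE /=; ring.
Qed.

Let kernel_coords (u : 'rV_6) : u *m coords = 0 ->
  exists x y, u = x *: dep_xy + y *: dep_xyz.
Proof.
move=> u0.
have eqn (l : 'I_4) := congr1 (fun v : 'rV_4 => v 0 l) u0.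
have := eqn (Ordinal (isT : (3 < 4)%N)).
have := eqn (Ordinal (isT : (2 < 4)%N)).
have := eqn (Ordinal (isT : (1 < 4)%N)).
have := eqn (Ordinal (isT : (0 < 4)%N)).
rewrite !mxE !big_ord6 !mxE /= => {u0 eqn}.
move=> e0 e1 e2 e3.
have [b'0 c'0] : 1 - b != 0 /\ 1 - c != 0.
  by split; rewrite subr_eq0 gt_eqF//; move: b01 c01 => /andP[_ ?] /andP[_ ?].
(* At y0 only [dep_xy] is nonzero and at z0 only [dep_xyz], so these entries determine the
   coefficients; the four coordinate equations force the other entries. *)
pose x := - u 0 q2 / (1 - b); pose y := - u 0 q4 / (1 - c).
have u2 : u 0 q2 = - (1 - b) * x by rewrite /x; field.
have u4 : u 0 q4 = - (1 - c) * y by rewrite /y; field.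
have u5 : u 0 q5 = - c * y by apply: (mulfI c'0); move: e2; rewrite u4; lra.
have u3 : u 0 q3 = - b * x + (1 - t) * y.
  by apply: (mulfI b'0); move: e1; rewrite u4 u5 u2; lra.
have u1 : u 0 q1 = a * x + s * t * y.
  by move: e0 e3; rewrite u4 u5 u3 u2; nra.
have u00 : u 0 q0 = (1 - a) * x + (1 - s) * t * y.
  by move: e3; rewrite u4 u5 u3 u2 u1; lra.
exists x, y; apply/rowP; apply: ord6_ind; rewrite !mxE /=;
  rewrite ?(u00, u1, u2, u3, u4, u5); ring.
Qed.

Let stretch : 'M[R]_6 := delta_mx q4 q5 + delta_mx q5 q4.

Definition six_sqd (k : R) (i j : 'I_6) : R :=
  \sum_l (coords i l - coords j l) ^+ 2 + k * stretch i j.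

(* The added column of the matrix isolates the omitted point m, so that only
   the dependencies of the other five points survive. *)
Let embedding_avoiding (m : 'I_6) (eps : R) (i1 i2 i3 : 'I_6) :
  let w i := eps * (dep_xy 0 m * dep_xyz 0 i - dep_xyz 0 m * dep_xy 0 i) in
  eps != 0 -> dep_xy 0 m != 0 -> [/\ 0 < w i1, 0 < w i2 & 0 < w i3] ->
  [/\ i1 != i2, i1 != i3 & i2 != i3] ->
  exists2 e : R, 0 < e & forall k, 0 < k <= e ->
    exists f : 'I_6 -> model R 6, forall i j, i != m -> j != m ->
      model_sqd (f i) (f j) = six_sqd k i j.
Proof.
move=> w epsN0 mN0 [w1 w2 w3] [i12 i13 i23].
(* The combination of the two dependencies that vanishes at [m], up to the factor [eps], which
   adjusts the sign. *)
pose v : 'rV[R]_6 := eps *: (dep_xy 0 m *: dep_xyz - dep_xyz 0 m *: dep_xy).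
have vE i : v 0 i = w i by rewrite /w !mxE.
have v_coords : v *m coords = 0.
  rewrite -scalemxAl mulmxBl -!scalemxAl dep_xy_coords dep_xyz_coords.
  by rewrite !scaler0 subrr scaler0.
pose A := row_mx coords (delta_mx m 0 : 'M[R]_(6, 1)).
have delta_m (u : 'rV[R]_6) : u *m (delta_mx m 0 : 'M[R]_(6, 1)) = (u 0 m)%:M.
  apply/matrixP => i j; rewrite !ord1 mxE (bigD1 m)//= big1 => [|l lm].
    by rewrite !mxE !eqxx mulr1 addr0.
  by rewrite !mxE (negbTE lm) mulr0.
have sumv : \sum_i v 0 i = 0.
  have := congr1 (fun u : 'rV_4 => u 0 (Ordinal (isT : (3 < 4)%N))) v_coords.
  rewrite [LHS]mxE [RHS]mxE => sum0.
  by rewrite big_ord6 ![coords _ _]mxE /= !mulr1 in sum0; rewrite big_ord6.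
have kerA (u : 'rV_6) : u *m A = 0 -> exists r, u = r *: v.
  rewrite mul_mx_row delta_m -row_mx0 => /eq_row_mx[/kernel_coords[x [y uE]]].
  move=> /matrixP/(_ 0 0); rewrite [LHS]mxE [RHS]mxE eqxx mulr1n.
  have -> : u 0 m = x * dep_xy 0 m + y * dep_xyz 0 m.
    by rewrite uE [LHS]mxE; congr (_ + _); rewrite mxE.
  move=> um; exists (y / (eps * dep_xy 0 m)); rewrite uE /v.
  have -> : x = - (y * dep_xyz 0 m) / dep_xy 0 m.
    by rewrite -(mulfK mN0 x); congr (_ / _); lra.
  rewrite scalerA scalerBr !scalerA.
  rewrite addrC; congr (_ + _).
    by congr (_ *: _); field; rewrite ?mN0 ?epsN0.
  by rewrite -scaleNr; congr (_ *: _); field; rewrite ?mN0 ?epsN0.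
have symS : stretch^T = stretch by rewrite linearD/= !trmx_delta addrC.
have diagS i : stretch i i = 0.
  rewrite !mxE; have [->|] := eqVneq i q4; first by rewrite /= addr0.
  by move=> _; rewrite andbF addr0.
rewrite -!vE in w1 w2 w3.
have [e e0 eP] := perturbation_embeds sumv kerA symS diagS w1 w2 w3 i12 i13 i23.
exists e => // k /eP[f fP]; exists f => i j im jm; rewrite fP /six_sqd.
congr (_ + _); rewrite big_split_ord/= [X in _ + X]big1 ?addr0.
  by apply: eq_bigr => l _; rewrite !row_mxEl.
move=> l _; rewrite !row_mxEr !mxE (negbTE im) (negbTE jm)/= subrr expr0n//.
Qed.

Lemma six_sqd_embeds : exists2 k : R, 0 < k &
  forall m, exists n, exists f : 'I_6 -> model R n, forall i j,
    i != m -> j != m -> model_sqd (f i) (f j) = six_sqd k i j.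
Proof.
have /andP[a0 a1] := a01; have /andP[b0 b1] := b01; have /andP[c0 c1] := c01.
have /andP[s0 s1] := s01; have /andP[t0 t1] := t01.
have [a' b' c'] : [/\ 0 < 1 - a, 0 < 1 - b & 0 < 1 - c].
  by rewrite !subr_gt0.
have [s' t' sa] : [/\ 0 < 1 - s, 0 < 1 - t & 0 < s - a].
  by rewrite !subr_gt0.
have [e1 e1_gt0 emb1] : exists2 e : R, 0 < e & forall k, 0 < k <= e ->
    exists f : 'I_6 -> model R 6, forall i j, i != q0 -> j != q0 ->
    model_sqd (f i) (f j) = six_sqd k i j.
  apply: (@embedding_avoiding q0 1 q1 q2 q3) => //.
  - by rewrite mxE/= ?oppr_eq0 gt_eqF.
  - rewrite !mxE/=; split.
    (* The entry at x1 is [t * (s - a)], positive because [a < s]. *)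
    + have := mulr_gt0 t0 sa; lra.
    + have := mulr_gt0 (mulr_gt0 s' t0) b'; lra.
    + have := mulr_gt0 a' t'; have := mulr_gt0 (mulr_gt0 s' t0) b0; lra.
have [e2 e2_gt0 emb2] : exists2 e : R, 0 < e & forall k, 0 < k <= e ->
    exists f : 'I_6 -> model R 6, forall i j, i != q1 -> j != q1 ->
    model_sqd (f i) (f j) = six_sqd k i j.
  apply: (@embedding_avoiding q1 (-1) q0 q4 q5) => //.
  - by rewrite mxE/= ?oppr_eq0 gt_eqF.
  - rewrite !mxE/=; split.
    + have := mulr_gt0 t0 sa; lra.
    + have := mulr_gt0 a0 c'; lra.
    + have := mulr_gt0 a0 c0; lra.
have [e3 e3_gt0 emb3] : exists2 e : R, 0 < e & forall k, 0 < k <= e ->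
    exists f : 'I_6 -> model R 6, forall i j, i != q2 -> j != q2 ->
    model_sqd (f i) (f j) = six_sqd k i j.
  apply: (@embedding_avoiding q2 (-1) q0 q1 q3) => //.
  - by rewrite mxE/= ?oppr_eq0 gt_eqF.
  - rewrite !mxE/=; split.
    + have := mulr_gt0 b' (mulr_gt0 s' t0); lra.
    + have := mulr_gt0 b' (mulr_gt0 s0 t0); lra.
    + have := mulr_gt0 b' t'; lra.
have [e4 e4_gt0 emb4] : exists2 e : R, 0 < e & forall k, 0 < k <= e ->
    exists f : 'I_6 -> model R 6, forall i j, i != q3 -> j != q3 ->
    model_sqd (f i) (f j) = six_sqd k i j.
  apply: (@embedding_avoiding q3 1 q2 q4 q5) => //.
  - by rewrite mxE/= ?oppr_eq0 gt_eqF.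
  - rewrite !mxE/=; split.
    + have := mulr_gt0 t' b'; lra.
    + have := mulr_gt0 b0 c'; lra.
    + have := mulr_gt0 b0 c0; lra.
(* Without z0 or z1 no distance is stretched, and the original points embed at the center of the
   star. *)
have flat k m : (forall i j, i != m -> j != m -> stretch i j = 0) ->
    exists n, exists f : 'I_6 -> model R n, forall i j,
    i != m -> j != m -> model_sqd (f i) (f j) = six_sqd k i j.
  move=> noS; exists 4%N.
  exists (fun i => exist (fun p : 'rV[R]_4 * (R * R) => cross p.2)
    (row i coords, (0, 0)) (introT eqP (mulr0 0))) => i j im jm.
  rewrite /model_sqd/= /l1dist/= subrr normr0 addr0 expr0n/= addr0.
  rewrite /six_sqd noS// mulr0 addr0.
  by apply: eq_bigr => l _; rewrite ![row _ _ _ _]mxE.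
pose k := Num.min (Num.min e1 e2) (Num.min e3 e4).
have k0 : 0 < k by rewrite !lt_min e1_gt0 e2_gt0 e3_gt0 e4_gt0.
have [k1 k2 k3 k4] : [/\ k <= e1, k <= e2, k <= e3 & k <= e4].
  by rewrite /k !ge_min !lexx !orbT.
exists k => //; apply: ord6_ind.
- by exists 6%N; apply: emb1; rewrite k0.
- by exists 6%N; apply: emb2; rewrite k0.
- by exists 6%N; apply: emb3; rewrite k0.
- by exists 6%N; apply: emb4; rewrite k0.
- by apply: flat => i j i4 j4; rewrite !mxE (negbTE i4) (negbTE j4) andbF addr0.
- by apply: flat => i j i5 j5; rewrite !mxE (negbTE i5) (negbTE j5) andbF addr0.
Qed.

(** The stretch only adds a nonnegative amount, so it suffices that the six points of R^3 are
    distinct. *)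
Lemma six_sqd_eq0 (k : R) (i j : 'I_6) : 0 <= k -> six_sqd k i j = 0 -> i = j.
Proof.
move=> k0 ij0.
have /andP[a0 a1] := a01; have /andP[b0 b1] := b01; have /andP[c0 c1] := c01.
have : \sum_l (coords i l - coords j l) ^+ 2 == 0.
  rewrite eq_le; apply/andP; split; last first.
    by apply: sumr_ge0 => l _; exact: sqr_ge0.
  rewrite -[leRHS]ij0 /six_sqd lerDl mulr_ge0// !mxE addr_ge0//; exact: ler0n.
rewrite psumr_eq0 => [/allP coord_eq|l _]; last exact: sqr_ge0.
have eqn (l : 'I_4) : coords i l = coords j l.
  apply/eqP; rewrite -subr_eq0; have := coord_eq l (mem_index_enum l).
  by rewrite sqrf_eq0.
have := eqn (Ordinal (isT : (2 < 4)%N)).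
have := eqn (Ordinal (isT : (1 < 4)%N)).
have := eqn (Ordinal (isT : (0 < 4)%N)).
rewrite !mxE {eqn coord_eq ij0}.
by elim/ord6_ind: i; elim/ord6_ind: j => //= *; exfalso; lra.
Qed.

(** Equality holds for the points of R^3, so the two sides differ exactly by [k] times the
    coefficient of the term of z0 and z1. *)
Lemma six_sqd_violates (k : R) : 0 < k ->
  (1 - s) * t * a * b * (1 - c) * six_sqd k q0 q4
  + s * t * a * b * (1 - c) * six_sqd k q1 q4
  + (1 - t) * a * b * (1 - c) * six_sqd k q3 q4
  + (1 - s) * t * a * b * c * six_sqd k q0 q5
  + s * t * a * b * c * six_sqd k q1 q5
  + (1 - t) * a * b * c * six_sqd k q3 q5
  + s * (1 - t) * t * (1 - a) * (1 - b) * six_sqd k q0 q2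
  + s * (1 - t) * t * a * (1 - b) * six_sqd k q1 q2
  + (1 - t) * t * (s - a) * b * six_sqd k q0 q3 <
  s * t * a * ((1 - t) * (1 - a) + (1 - s) * t * b) * six_sqd k q0 q1
  + s * (1 - t) * t * (1 - b) * b * six_sqd k q2 q3
  + a * b * (1 - c) * c * six_sqd k q4 q5.
Proof.
move=> k0; have /andP[a0 a1] := a01; have /andP[b0 b1] := b01.
have /andP[c0 c1] := c01.
rewrite -subr_gt0 (_ : _ - _ = a * b * (1 - c) * c * k).
  by rewrite !mulr_gt0// subr_gt0.
rewrite /six_sqd !big_ord_recl !big_ord0 !mxE /=; ring.
Qed.

Lemma six_sqd_sym (k : R) (i j : 'I_6) : six_sqd k i j = six_sqd k j i.
Proof.
rewrite /six_sqd; congr (_ + _ * _); last first.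
  by rewrite !mxE addrC !(andbC (i == _)).
by apply: eq_bigr => l _; rewrite -sqrrN opprB.
Qed.

Lemma six_sqdxx (k : R) (i : 'I_6) : six_sqd k i i = 0.
Proof.
rewrite /six_sqd big1 => [|l _]; last by rewrite subrr expr0n.
rewrite add0r !mxE; have [->|_] := eqVneq i q4; first by rewrite /= addr0 mulr0.
by rewrite andbF addr0 mulr0.
Qed.

Lemma six_point_counterexample : exists L : metricType R,
  [/\ [set: L] #= `I_6,
      (forall A : set L, A #= `I_5 ->
         exists X : metricType R,
           CAT0 X /\ exists f : L -> X, dist_preserving_on A f)
    & exists x0 x1 y0 y1 z0 z1 : L,
        ~ six_point_ineq a b c s t x0 x1 y0 y1 z0 z1].
Proof.
have [k k0 emb] := six_sqd_embeds.
have D0 i j : 0 <= six_sqd k i j.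
  have [m [im jm _]] := exists_ord6_avoiding i j j.
  by have [n [f fP]] := emb m; rewrite -fP// model_sqd_ge0.
have Dtri j i l : Num.sqrt (six_sqd k i l) <=
    Num.sqrt (six_sqd k i j) + Num.sqrt (six_sqd k j l).
  have [m [im jm lm]] := exists_ord6_avoiding i j l.
  by have [n [f fP]] := emb m; rewrite -!fP// model_sqd_triangle.
pose d := Sqdist D0 (six_sqdxx k) (fun i j => six_sqd_eq0 (ltW k0))
  (six_sqd_sym k) Dtri.
have card6 : [set: 'I_6] #= `I_6 by rewrite card_eq_sym card_II.
exists (metric_of d); split; first exact: card6.
(* Five points miss some [m], and the embedding that omits [m] serves for all of [A]. *)
- move=> A A5; have [m mA] : exists m : 'I_6, ~ A m.
    apply: contrapT => allA.
    have AT : A = [set: 'I_6].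
      apply/seteqP; split=> // m _; apply: contrapT => mA.
      by apply: allA; exists m.
    rewrite AT in A5.
    by have /card_eq_II := card_eq_trans (card_esym card6) A5.
  have [n [f fP]] := emb m; exists (model_space R n); split.
    exact: model_CAT0.
  exists f => i j; rewrite !inE => Ai Aj.
  have neq (l : 'I_6) : A l -> l != m.
    by move=> Al; apply/eqP => lm; apply: mA; rewrite -lm.
  rewrite !mdist_metric_of/= fP//; exact: neq.
- exists q0, q1, q2, q3, q4, q5; rewrite /six_point_ineq !mdist_sqr.
  by apply/negP; rewrite -ltNge; exact: six_sqd_violates.
Qed.

End SixPoints.

Theorem theorem1p3 (R : realType) :
  (forall X : metricType R, CAT0 X ->
    forall a b c s t : R,
      0 <= a <= 1 -> 0 <= b <= 1 -> 0 <= c <= 1 -> 0 <= s <= 1 ->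
      0 <= t <= 1 -> a <= s ->
    forall x0 x1 y0 y1 z0 z1 : X,
      six_point_ineq a b c s t x0 x1 y0 y1 z0 z1)
  /\
  (forall a b c s t : R,
      0 < a < 1 -> 0 < b < 1 -> 0 < c < 1 -> 0 < s < 1 ->
      0 < t < 1 -> a < s ->
    exists L : metricType R,
      [/\ [set: L] #= `I_6,
          (forall A : set L, A #= `I_5 ->
             exists X : metricType R,
               CAT0 X /\ exists f : L -> X, dist_preserving_on A f)
        & exists x0 x1 y0 y1 z0 z1 : L,
            ~ six_point_ineq a b c s t x0 x1 y0 y1 z0 z1]).
Proof.
split=> [X X0 a b c s t a01 b01 c01 s01 t01 les x0 x1 y0 y1 z0 z1|].
  exact: CAT0_six_point.
by move=> a b c s t *; exact: six_point_counterexample.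
Qed.
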